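(* Let $N \ge 2$ and $M \ge 1$ be integers. Then there is no interruptible algorithm in the passive setting for obtaining an observation exactly from the common stationary distribution of $M$ independent irreducible aperiodic reversible Markov chains on $N$ states (with possibly different transition matrices). That is, there is no collection of functions $\phi_{k,i}$ ($k\ge 0$, $i\in[N]$) satisfying properties (i), (ii), (iii) and (iv$'$) of the context, in which (iii) and (iv$'$) are required only for reversible chains.
   Context: Write $[N]=\{1,\dots,N\}$. A transition matrix $\mathbf{P}=(p_{ij})$ with stationary distribution $\pi$ is reversible if $\pi_i p_{ij} = \pi_j p_{ji}$ for all $i,j$. An algorithm is a collection of functions $\phi_{k,i}: ([N]^M)^{k+1} \to [0,1]$, $k \ge 0$, $i\in[N]$, where $\phi_{k,i}(x(0),\dots,x(k))$, with $x(t) = (x_1(t),\dots,x_M(t)) \in [N]^M$, is interpreted as the conditional probability that the algorithm stops by time $k$ and outputs $i$, given that the $M$ observed trajectories through time $k$ are $(x_l(0),\dots,x_l(k))$, $1\le l\le M$. The functions do not depend on the transition matrices or the initial distribution. For a probability distribution $\rho$ on $[N]^M$ and transition matrices $\mathbf{P}^{(1)},\dots,\mathbf{P}^{(M)}$ on $[N]$, with $\mathbf{P}^{(l)} = (p^{(l)}_{ij})$, put $$a_{k,i} := \sum_{x(0),\dots,x(k)\in[N]^M} \rho(x(0)) \left[\prod_{l=1}^M \prod_{t=1}^k p^{(l)}_{x_l(t-1),x_l(t)}\right] \phi_{k,i}(x(0),\dots,x(k)).$$ The required properties are: (i) for all $k\ge 0$ and all $(x(0),\dots,x(k))$: $\sum_{j\in[N]}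 \phi_{k,j}(x(0),\dots,x(k)) \le 1$; (ii) for all $i\in[N]$ and all infinite sequences $(x(0),x(1),\dots)$ in $[N]^M$, $\phi_{k,i}(x(0),\dots,x(k))$ is nondecreasing in $k$; and, for all irreducible aperiodic reversible transition matrices $\mathbf{P}^{(1)},\dots,\mathbf{P}^{(M)}$ on $[N]$ (possibly different) having a common stationary distribution $\pi$, and every probability distribution $\rho$ on $[N]^M$: (iii) $\lim_{k\to\infty} \sum_{j\in[N]} a_{k,j} > 0$ (the algorithm stops with positive probability); (iv$'$) for all $i\in[N]$ and all $k\ge 0$: $a_{k,i} = \pi_i \sum_{j\in[N]} a_{k,j}$ (the output is distributed as $\pi$, independently of the stopping time). *)

(* Defs.v *)
From mathcomp Require Import all_boot all_order all_algebra.
From mathcomp Require Import all_classical all_reals all_analysis.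

Set Implicit Arguments.
Unset Strict Implicit.
Unset Printing Implicit Defensive.

Import Order.TTheory GRing.Theory Num.Theory.
Import numFieldNormedType.Exports.

Local Open Scope classical_set_scope.
Local Open Scope ring_scope.

Definition is_distr (R : realType) (T : finType) (f : T -> R) : Prop :=
  (forall x, 0 <= f x) /\ \sum_x f x = 1.

Definition transition_matrix (R : realType) (N : nat) (P : 'M[R]_N) : Prop :=
  forall i, is_distr (P i).

Definition irreducible_chain (R : realType) (N : nat) (P : 'M[R]_N) : Prop :=
  forall i j, exists n, 0 < (P ^+ n) i j.

(* [d] is the gcd of the set of return times {n >= 1 | (P ^+ n) i i > 0},
   expressed by the universal property of the gcd. *)
Definition is_period (R : realType) (N : nat) (P : 'M[R]_N) (i : 'I_N)
    (d : nat) : Prop :=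
  forall e : nat,
    (e %| d)%N <->
    (forall n : nat, (0 < n)%N -> 0 < (P ^+ n) i i -> (e %| n)%N).

Definition aperiodic_chain (R : realType) (N : nat) (P : 'M[R]_N) : Prop :=
  forall i, is_period P i 1.

Definition stationary (R : realType) (N : nat) (pi : 'rV[R]_N)
    (P : 'M[R]_N) : Prop :=
  is_distr (pi 0) /\ pi *m P = pi.

Definition reversible (R : realType) (N : nat) (pi : 'rV[R]_N)
    (P : 'M[R]_N) : Prop :=
  forall i j, pi 0 i * P i j = pi 0 j * P j i.

(* The states 1, ..., N and the chains 1, ..., M are indexed from 0. *)
Definition joint_state (N M : nat) := {ffun 'I_M -> 'I_N}.

Definition history (N M k : nat) := {ffun 'I_k.+1 -> joint_state N M}.

Definition prefix_of (N M : nat) (x : nat -> joint_state N M) (k : nat) :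
  history N M k := [ffun t : 'I_k.+1 => x t].

Definition algorithm (R : realType) (N M : nat) :=
  forall k : nat, 'I_N -> history N M k -> R.

(* The step index [t < k] stands for the transition from time [t] (the index
   [widen_ord _ t]) to time [t + 1] (the index [lift ord0 t]). *)
Definition path_weight (R : realType) (N M : nat) (rho : joint_state N M -> R)
    (P : 'I_M -> 'M[R]_N) (k : nat) (x : history N M k) : R :=
  rho (x ord0) *
  \prod_(l < M) \prod_(t < k)
    P l (x (widen_ord (leqnSn k) t) l) (x (lift ord0 t) l).

Definition stop_output_prob (R : realType) (N M : nat)
    (rho : joint_state N M -> R) (P : 'I_M -> 'M[R]_N)
    (phi : algorithm R N M) (k : nat) (i : 'I_N) : R :=
  \sum_(x : history N M k) path_weight rho P x * phi k i x.

(* The positive limit is stated together with its existence, because [limn]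
   has a default value on divergent sequences. *)
Definition stops_with_positive_prob (R : realType) (N M : nat)
    (rho : joint_state N M -> R) (P : 'I_M -> 'M[R]_N)
    (phi : algorithm R N M) : Prop :=
  exists2 p : R, 0 < p &
    (fun k => \sum_j stop_output_prob rho P phi k j) @ \oo --> p.

Definition interruptible_exact (R : realType) (N M : nat) (pi : 'rV[R]_N)
    (rho : joint_state N M -> R) (P : 'I_M -> 'M[R]_N)
    (phi : algorithm R N M) : Prop :=
  forall (i : 'I_N) (k : nat),
    stop_output_prob rho P phi k i =
    pi 0 i * \sum_j stop_output_prob rho P phi k j.

Definition interruptible_algorithm_reversible (R : realType) (N M : nat)
    (phi : algorithm R N M) : Prop :=
  [/\ forall k i x, 0 <= phi k i x <= 1,
      forall k x, \sum_j phi k j x <= 1,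
      forall (i : 'I_N) (x : nat -> joint_state N M) (k k' : nat),
        (k <= k')%N ->
        phi k i (prefix_of x k) <= phi k' i (prefix_of x k') &
      forall (pi : 'rV[R]_N) (P : 'I_M -> 'M[R]_N)
             (rho : joint_state N M -> R),
        (forall l, [/\ transition_matrix (P l), irreducible_chain (P l),
                       aperiodic_chain (P l), stationary pi (P l) &
                       reversible pi (P l)]) ->
        is_distr rho ->
        stops_with_positive_prob rho P phi /\
        interruptible_exact pi rho P phi].

(* Main.v *)
Require Import Defs.
From mathcomp Require Import all_boot all_order all_algebra.
From mathcomp Require Import all_classical all_reals all_analysis.
From mathcomp Require Import ring lra.

Set Implicit Arguments.
Unset Strict Implicit.
Unset Printing Implicit Defensive.

Import Order.TTheory GRing.Theory Num.Theory.
Import numFieldNormedType.Exports.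

Local Open Scope ring_scope.

(** Chains that rarely jump defeat any such algorithm.  Fix a horizon [k] and a
deterministic start.  For positive [s] and costs [u l v >= 1], let chain [l]
jump from [i] to [j] with probability [e ^+ (u l i + u l j) * (s j / s i)];
for small [e > 0] it is irreducible, aperiodic and reversible with respect to
[pi_i] proportional to [s i ^+ 2] ([jump_mx_admissible]).  The weight of a
history is then [e] to the power of its total jump cost, times a polynomial in
[e] whose constant term telescopes to the product over [l] of
[s (final state) / s (initial state)] ([path_poly_coef0]).

That the output has law [pi] at every horizon is a polynomial identity in [e],
so it holds coefficient by coefficient ([poly_eq0_near0]).  In the lowest degree only the cheapest
histories on which the algorithm stops survive.  The costs are powers of a
large base, so the total cost tells how often the jumps of each chain leave or
enter each state; the parity of these numbers, together with the start, gives
the final states ([separating_cost_end]).  Hence the cheapest stopping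
histories share both ends, the factor in [s] is common to all of them and
cancels, and what remains is [c_i = pi_i * \sum_j c_j] with a vector [c] that
does not depend on [s] and has positive sum ([leading_balance]).  Different
choices of [s] give different [pi], a contradiction.  A history on which the
algorithm stops exists because it stops with positive probability
([some_history_stops]). *)

(** * Base expansions, polynomials and telescoping *)

Lemma expansion_inj (B n : nat) (f g : 'I_n -> nat) :
  (forall i, (f i < B)%N) -> (forall i, (g i < B)%N) ->
  (\sum_(i < n) f i * B ^ i = \sum_(i < n) g i * B ^ i)%N -> f =1 g.
Proof.
elim: n f g => [|n IH] f g ltf ltg; first by move=> _ [].
have split_low (h : 'I_n.+1 -> nat) : (\sum_(i < n.+1) h i * B ^ i =
    (\sum_(i < n) h (lift ord0 i) * B ^ i) * B + h ord0)%N.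
  rewrite big_ord_recl expn0 muln1 addnC; congr (_ + _)%N.
  rewrite big_distrl; apply: eq_bigr => i _ /=.
  by rewrite /bump /= add1n expnS mulnCA mulnC.
have B_gt0 : (0 < B)%N by apply: leq_ltn_trans (ltf ord0).
rewrite !split_low => eqfg.
have eq0 : f ord0 = g ord0.
  have /(congr1 (modn^~ B)) := eqfg.
  by rewrite !modnMDl !modn_small.
have eqS : (fun i => f (lift ord0 i)) =1 (fun i => g (lift ord0 i)).
  apply: IH => [i|i|]; [exact: ltf | exact: ltg |].
  apply/eqP; rewrite -(eqn_pmul2r B_gt0) -(eqn_add2r (f ord0)).
  by rewrite eqfg eq0.
move=> i; case: (unliftP ord0 i) => [j ->|->]; [exact: eqS | exact: eq0].
Qed.

Lemma poly_eq0_near0 (R : realFieldType) (p : {poly R}) (e0 : R) :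
  0 < e0 -> (forall e, 0 < e -> e < e0 -> p.[e] = 0) -> p = 0.
Proof.
move=> e0_gt0 vanish; apply: contraTeq isT => p_neq0.
pose pt n : R := e0 / n.+2%:R.
pose rs := [seq pt n | n <- iota 0 (size p)].
have roots : all (root p) rs.
  apply/allP => _ /mapP [n _ ->]; apply/rootP/vanish.
    by rewrite divr_gt0.
  by rewrite ltr_pdivrMr // ltr_pMr // ltr1n.
have uniq_rs : uniq rs.
  rewrite map_inj_uniq ?iota_uniq // => m n /(mulfI (lt0r_neq0 e0_gt0)).
  by move=> /invr_inj /eqP; rewrite eqr_nat => /eqP [].
by have := max_poly_roots p_neq0 roots uniq_rs; rewrite size_map size_iota ltnn.
Qed.

(** Used twice: with [d a b := s b / s a] for the constant term of a path
weight, and with exclusive or for the parity of visits. *)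
Lemma big_step_telescope (T G : Type) (idx : G) (op : Monoid.law idx)
    (d : T -> T -> G) :
  (forall a, d a a = idx) -> (forall a b c, op (d a b) (d b c) = d a c) ->
  forall (k : nat) (f : 'I_k.+1 -> T),
    \big[op/idx]_(t < k) d (f (widen_ord (leqnSn k) t)) (f (lift ord0 t)) =
    d (f ord0) (f ord_max).
Proof.
move=> d_id d_comp; elim=> [|k IH] f.
  rewrite big_ord0; have -> : ord_max = ord0 :> 'I_1 by apply: val_inj.
  by rewrite d_id.
have IHf := IH (fun t => f (widen_ord (leqnSn k.+1) t)).
rewrite big_ord_recr /=.
under eq_bigr => t _ do
  have -> : lift ord0 (widen_ord (leqnSn k) t) =
            widen_ord (leqnSn k.+1) (lift ord0 t) by apply: val_inj.
rewrite IHf.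
have -> : lift ord0 ord_max = ord_max :> 'I_k.+2 by apply: val_inj.
have -> : widen_ord (leqnSn k.+1) ord0 = ord0 by apply: val_inj.
exact: d_comp.
Qed.

(** * Jump costs determine the final states *)

Section Touches.
Variables (N : nat).

Definition step_touches (a b v : 'I_N) : nat :=
  if a == b then 0 else ((a == v) + (b == v))%N.

Definition jump_cost (u : 'I_N -> nat) (a b : 'I_N) : nat :=
  if a == b then 0 else (u a + u b)%N.

Lemma jump_costE u a b :
  jump_cost u a b = (\sum_v step_touches a b v * u v)%N.
Proof.
have pick c : (\sum_v (c == v) * u v = u c)%N.
  rewrite (bigD1 c) //= eqxx mul1n big1 ?addn0 // => v.
  by rewrite eq_sym => /negbTE ->.
rewrite /jump_cost /step_touches; case: ifP => _; first by rewrite big1.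
by under eq_bigr => v _ do rewrite mulnDl; rewrite big_split /= !pick.
Qed.

Lemma odd_step_touches a b v :
  odd (step_touches a b v) = (a == v) (+) (b == v).
Proof.
rewrite /step_touches; case: (eqVneq a b) => [->|_]; first by rewrite addbb.
by rewrite oddD !oddb.
Qed.

Variables (M k : nat).
Implicit Types (x y : history N M k) (u : 'I_M -> 'I_N -> nat).

Definition touches x (l : 'I_M) (v : 'I_N) : nat :=
  \sum_(t < k)
    step_touches (x (widen_ord (leqnSn k) t) l) (x (lift ord0 t) l) v.

Definition history_cost u x : nat :=
  (\sum_(l < M) \sum_(t < k)
    jump_cost (u l) (x (widen_ord (leqnSn k) t) l) (x (lift ord0 t) l))%N.

Lemma touches_le x l v : (touches x l v <= k.*2)%N.
Proof.
apply: (@leq_trans (\sum_(t < k) 2)%N); last first.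
  by rewrite sum_nat_const card_ord muln2.
apply: leq_sum => t _; rewrite /step_touches; case: ifP => // _.
by do 2 case: (_ == _).
Qed.

Lemma odd_touches x l v :
  odd (touches x l v) = (x ord0 l == v) (+) (x ord_max l == v).
Proof.
rewrite /touches (big_morph odd oddD (erefl : odd 0 = false)).
under eq_bigr => t _ do rewrite odd_step_touches.
apply: (@big_step_telescope _ _ _ addb (fun a b : 'I_N => (a == v) (+) (b == v))
  _ _ k (fun t => x t l)) => [a|a b c]; first exact: addbb.
by rewrite /= addbA -(addbA (a == v)) addbb addbF.
Qed.

Lemma history_costE u x :
  history_cost u x =
  (\sum_(e : 'I_M * 'I_N) touches x e.1 e.2 * u e.1 e.2)%N.
Proof.
rewrite /history_cost -(pair_big xpredT xpredT (fun l v => touches x l v * u l v)%N) /=.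
apply: eq_bigr => l _; under eq_bigr => t _ do rewrite jump_costE.
by rewrite exchange_big; apply: eq_bigr => v _; rewrite /touches big_distrl.
Qed.

(** The base exceeds the bound [k.*2] of [touches_le], so the numbers of touches
are the digits of the total cost. *)
Definition separating_cost (l : 'I_M) (v : 'I_N) : nat :=
  (k.*2.+1 ^ enum_rank (l, v))%N.

(** A state is touched an odd number of times exactly when it is one, but not
both, of the two ends of the trajectory. *)
Lemma separating_cost_end x y :
  x ord0 = y ord0 ->
  history_cost separating_cost x = history_cost separating_cost y ->
  x ord_max = y ord_max.
Proof.
move=> eq_start; rewrite !history_costE => eq_cost.
have eq_touches l v : touches x l v = touches y l v.
  pose digits z (i : 'I_#|{: 'I_M * 'I_N}|) :=
    touches z (enum_val i).1 (enum_val i).2.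
  have lt_digits z i : (digits z i < k.*2.+1)%N by rewrite ltnS touches_le.
  have expand z : (\sum_i digits z i * k.*2.+1 ^ i =
      \sum_(e : 'I_M * 'I_N) touches z e.1 e.2 * separating_cost e.1 e.2)%N.
    rewrite [RHS](reindex (@enum_val _ (mem {: 'I_M * 'I_N}))) /=; last first.
      exact/onW_bij/enum_val_bij.
    apply: eq_bigr => i _; rewrite /separating_cost -surjective_pairing.
    by rewrite enum_valK.
  have := expansion_inj (lt_digits x) (lt_digits y).
  rewrite !expand => /(_ eq_cost (enum_rank (l, v))).
  by rewrite /digits enum_rankK.
apply/ffunP => l; apply/eqP.
have := odd_touches x l (y ord_max l).
by rewrite eq_touches odd_touches eq_start eqxx => /addbI <-.
Qed.

End Touches.

(** * Reversible chains with rare jumps *)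

Section SmallJumps.
Variables (R : realType) (N : nat).
Implicit Types (s : 'I_N -> R) (u : 'I_N -> nat) (e : R).

Definition square_law s : 'rV[R]_N :=
  \row_i (s i ^+ 2 / \sum_j s j ^+ 2).

(** The transition probability from [i] to [j] divided by [e ^+ jump_cost u i j],
as a polynomial in [e]: with this power split off, the constant term is
[s j / s i] also for [i = j]. *)
Definition step_poly u s (i j : 'I_N) : {poly R} :=
  if i == j then 1 - \sum_(v | v != i) (s v / s i) *: 'X^(u i + u v)
  else (s j / s i)%:P.

Definition jump_mx u s e : 'M[R]_N :=
  \matrix_(i, j) (e ^+ jump_cost u i j * (step_poly u s i j).[e]).

(** For positive [e] below this value and positive costs, the probability of
leaving any state is smaller than 1. *)
Definition jump_threshold s : R := (1 + \sum_i \sum_j s j / s i)^-1.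

Lemma jump_mx_off u s e i j :
  i != j -> jump_mx u s e i j = e ^+ (u i + u j) * (s j / s i).
Proof. by move/negbTE=> ij; rewrite mxE /jump_cost /step_poly ij hornerC. Qed.

Lemma jump_mx_diag u s e i :
  jump_mx u s e i i = 1 - \sum_(v | v != i) e ^+ (u i + u v) * (s v / s i).
Proof.
rewrite mxE /jump_cost /step_poly eqxx expr0 mul1r hornerD hornerN hornerC.
rewrite horner_sum; congr (1 - _); apply: eq_bigr => v _.
by rewrite hornerZ hornerXn mulrC.
Qed.

Lemma jump_mx_row_sum u s e i : \sum_j jump_mx u s e i j = 1.
Proof.
rewrite (bigD1 i) //= jump_mx_diag -addrA [X in _ + X]addrC.
under [X in _ + (X - _)]eq_bigr => j ji do rewrite jump_mx_off 1?eq_sym //.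
by rewrite subrr addr0.
Qed.

Lemma step_poly_coef0 u s i j :
  (forall v, 0 < s v) -> (forall v, (0 < u v)%N) ->
  (step_poly u s i j)`_0 = s j / s i.
Proof.
move=> s_gt0 u_gt0; rewrite /step_poly; case: eqVneq => [<-|_]; last first.
  by rewrite coefC.
rewrite divff ?gt_eqF // coefB coefC coef_sum big1 ?subr0 // => v _.
by rewrite coefZ coefXn ltn_eqF ?mulr0 // addn_gt0 u_gt0.
Qed.

Section Admissible.
Variables (u : 'I_N -> nat) (s : 'I_N -> R).
Hypotheses (s_gt0 : forall v, 0 < s v) (u_gt0 : forall v, (0 < u v)%N).

Let ratio_ge0 i j : 0 <= s j / s i.
Proof. by rewrite divr_ge0 // ltW. Qed.

Let rows_ge0 i : 0 <= \sum_j s j / s i.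
Proof. by rewrite sumr_ge0. Qed.

Lemma jump_threshold_gt0 : 0 < jump_threshold s.
Proof. by rewrite invr_gt0 ltr_pwDl ?ltr01 ?sumr_ge0. Qed.

Variable e : R.
Hypotheses (e_gt0 : 0 < e) (e_lt : e < jump_threshold s).

(** Costs are positive and [e <= 1], so each jump from [i] has probability at
most [e * (s v / s i)], and these bounds sum to less than 1. *)
Lemma jump_mx_gt0 i j : 0 < jump_mx u s e i j.
Proof.
have [<-|ij] := eqVneq i j; last first.
  by rewrite jump_mx_off // mulr_gt0 ?exprn_gt0 ?divr_gt0.
have inv_gt0 : 0 < (jump_threshold s)^-1 by rewrite invr_gt0 jump_threshold_gt0.
have e_le1 : e <= 1.
  apply: (le_trans (ltW e_lt)); rewrite /jump_threshold invf_le1.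
    by rewrite lerDl sumr_ge0.
  by rewrite -[ltRHS]invrK.
rewrite jump_mx_diag subr_gt0.
apply: (@le_lt_trans _ _ (e * (jump_threshold s)^-1)); last first.
  by rewrite ltr_pdivrMr ?jump_threshold_gt0 // mul1r.
apply: (@le_trans _ _ (\sum_v e * (s v / s i))).
  rewrite [leRHS](bigID (fun v => v != i)) /= ler_wpDr //.
    by rewrite sumr_ge0 // => v _; rewrite mulr_ge0 // ltW.
  apply: ler_sum => v _; rewrite ler_wpM2r //.
  have -> : (u i + u v = (u i + u v).-1.+1)%N.
    by rewrite prednK // addn_gt0 u_gt0.
  by rewrite exprS ler_piMr ?(ltW e_gt0) // exprn_ile1 // ltW.
rewrite -mulr_sumr ler_wpM2l ?(ltW e_gt0) // invrK.
by rewrite [X in _ <= 1 + X](bigD1 i) //= addrCA lerDl addr_ge0 // sumr_ge0.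
Qed.

Lemma square_law_distr (i0 : 'I_N) : is_distr (square_law s 0).
Proof.
have sq_ge0 v : 0 <= s v ^+ 2 by rewrite exprn_ge0 // ltW.
have tot_gt0 : 0 < \sum_v s v ^+ 2.
  by rewrite (bigD1 i0) //= ltr_pwDl ?exprn_gt0 ?sumr_ge0.
split=> [i|]; first by rewrite mxE divr_ge0 // ltW.
by under eq_bigr => i _ do rewrite mxE; rewrite -mulr_suml divff ?gt_eqF.
Qed.

(** The flow from [i] to [j] is proportional to the symmetric expression
[e ^+ (u i + u j) * s i * s j]. *)
Lemma jump_mx_reversible : reversible (square_law s) (jump_mx u s e).
Proof.
move=> i j; have [->//|ij] := eqVneq i j.
have ji : j != i by rewrite eq_sym.
rewrite !jump_mx_off // !mxE (addnC (u j)).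
have si : s i != 0 by rewrite gt_eqF.
have sj : s j != 0 by rewrite gt_eqF.
rewrite !mulrA; move: (e ^+ _) (\sum_j _)^-1 => p q.
by field; rewrite si sj.
Qed.

Lemma jump_mx_admissible (i0 : 'I_N) :
  [/\ transition_matrix (jump_mx u s e), irreducible_chain (jump_mx u s e),
      aperiodic_chain (jump_mx u s e),
      stationary (square_law s) (jump_mx u s e) &
      reversible (square_law s) (jump_mx u s e)].
Proof.
split; last exact: jump_mx_reversible.
- by move=> i; split=> [j|]; [exact/ltW/jump_mx_gt0 | exact: jump_mx_row_sum].
- by move=> i j; exists 1%N; rewrite expr1 jump_mx_gt0.
- move=> i d; split=> [|dvd_returns].
    by rewrite dvdn1 => /eqP-> n _ _; apply: dvd1n.
  by apply: dvd_returns; rewrite // expr1 jump_mx_gt0.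
- split; first exact: square_law_distr i0.
  apply/rowP => j; rewrite mxE.
  under eq_bigr => i _ do rewrite jump_mx_reversible.
  by rewrite -mulr_sumr jump_mx_row_sum mulr1.
Qed.

End Admissible.
End SmallJumps.

(** * Lowest-order terms of the output probabilities *)

Section LeadingOrder.
Variables (R : realType) (N M k : nat).
Implicit Types (u : 'I_M -> 'I_N -> nat) (s : 'I_N -> R) (x : history N M k).

Definition start_at (y z : joint_state N M) : R := (z == y)%:R.

Lemma start_at_distr y : is_distr (start_at y).
Proof.
split=> [z|]; first by rewrite /start_at ler0n.
rewrite /start_at (bigD1 y) //= eqxx big1 ?addr0 // => z.
by move=> /negbTE ->.
Qed.

Definition path_poly u s x : {poly R} :=
  \prod_(l < M) \prod_(t < k)
    step_poly (u l) s (x (widen_ord (leqnSn k) t) l) (x (lift ord0 t) l).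

Lemma path_weight_jump rho u s e x :
  path_weight rho (fun l => jump_mx (u l) s e) x =
  rho (x ord0) * ('X^(history_cost u x) * path_poly u s x).[e].
Proof.
rewrite hornerM hornerXn /history_cost /path_poly /path_weight.
rewrite horner_prod -prodrXr -big_split /=; congr (_ * _).
apply: eq_bigr => l _; rewrite horner_prod -prodrXr -big_split /=.
by apply: eq_bigr => t _; rewrite mxE.
Qed.

Lemma path_poly_coef0 u s x :
  (forall v, 0 < s v) -> (forall l v, (0 < u l v)%N) ->
  (path_poly u s x)`_0 = \prod_(l < M) (s (x ord_max l) / s (x ord0 l)).
Proof.
move=> s_gt0 u_gt0; rewrite coef0_prod; apply: eq_bigr => l _.
rewrite coef0_prod; under eq_bigr => t _ do rewrite step_poly_coef0 //.
have s_neq0 v : s v != 0 by rewrite gt_eqF.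
apply: (@big_step_telescope _ _ _ *%R (fun a b => s b / s a) _ _ k
  (fun t => x t l)) => [a|a b c] /=; first exact: divff.
by rewrite mulrC mulrA divfK.
Qed.

Variable phi : algorithm R N M.
Hypothesis phiP : interruptible_algorithm_reversible phi.

Lemma output_ge0 i x : 0 <= phi i x.
Proof. by case: phiP => /(_ k i x) /andP []. Qed.

(** The witness [c i] is the sum of [phi i] over the stopping histories of
minimal cost with the same start as [x0].  Neither the stopping histories nor
their costs involve [s], so the same [c] serves every [s]. *)
Lemma leading_balance (x0 : history N M k) :
  0 < \sum_j phi j x0 ->
  exists c : 'I_N -> R, 0 < \sum_j c j /\
    forall s, (forall v, 0 < s v) ->
    forall i, c i = square_law s 0 i * \sum_j c j.
Proof.
move=> stop_x0.
pose u := @separating_cost N M k.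
have u_gt0 l v : (0 < u l v)%N by rewrite expn_gt0.
pose y := x0 ord0.
pose stopping x := (x ord0 == y) && (0 < \sum_j phi j x).
have stopping_x0 : stopping x0 by rewrite /stopping eqxx.
case: (arg_minnP (history_cost u) stopping_x0) => z /andP [/eqP z_start z_stop].
set m := history_cost u z => m_min.
pose leading x := stopping x && (history_cost u x == m).
pose c i := \sum_(x | leading x) phi i x.
have sum_c : \sum_j c j = \sum_(x | leading x) \sum_j phi j x.
  exact: exchange_big.
exists c; split=> [|s s_gt0 i].
  rewrite sum_c (bigD1 z) /=; last by rewrite /leading /stopping z_start z_stop !eqxx.
  rewrite ltr_pwDl // sumr_ge0 // => x _; rewrite sumr_ge0 // => j _.
  exact: output_ge0.
pose defect x := phi i x - square_law s 0 i * \sum_j phi j x.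
(* Histories on which the algorithm has not stopped contribute nothing, since
   every output has probability 0 there. *)
have defect_stop x : ~~ (0 < \sum_j phi j x) -> defect x = 0.
  have phi_ge0 j : true -> 0 <= phi j x by move=> _; apply: output_ge0.
  rewrite lt_def sumr_ge0 // andbT negbK => /eqP sum0.
  rewrite /defect sum0 mulr0 subr0.
  have /eqP := sum0; rewrite psumr_eq0 // => /allP /(_ i).
  by rewrite mem_index_enum => /(_ isT) /eqP.
pose F : {poly R} := \sum_(x : history N M k | x ord0 == y)
  defect x *: ('X^(history_cost u x) * path_poly u s x).
have F0 : F = 0.
  apply: (poly_eq0_near0 (jump_threshold_gt0 s_gt0)) => e e_gt0 e_lt.
  pose P l := jump_mx (u l) s e.
  have P_admissible l := jump_mx_admissible s_gt0 (u_gt0 l) e_gt0 e_lt i.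
  have [_ _ _ /(_ _ P _ P_admissible (start_at_distr y)) [_ /(_ i k)]] := phiP.
  move/eqP; rewrite -subr_eq0 => /eqP balance.
  rewrite -[RHS]balance /stop_output_prob exchange_big /= mulr_sumr -sumrB.
  rewrite horner_sum big_mkcond; apply: eq_bigr => x _.
  rewrite -mulr_sumr mulrCA -mulrBr path_weight_jump /start_at.
  by case: eqP => _; rewrite ?mul0r // mul1r hornerZ mulrC.
(* [r] is the constant term shared by all leading histories. *)
pose r := \prod_(l < M) (s (z ord_max l) / s (z ord0 l)).
have r_neq0 : r != 0.
  by apply/prodf_neq0 => l _; rewrite mulf_neq0 ?invr_eq0 ?gt_eqF.
have : F`_m = r * \sum_(x | leading x) defect x.
  rewrite coef_sum mulr_sumr /leading /stopping big_mkcond [RHS]big_mkcond /=.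
  apply: eq_bigr => x _; case: (eqVneq (x ord0) y) => //= x_start.
  rewrite coefZ coefXnM.
  case: (boolP (0 < \sum_j phi j x)) => /= x_stop; last first.
    by rewrite defect_stop ?mul0r.
  have := m_min x; rewrite /stopping x_start eqxx x_stop => /(_ isT).
  rewrite leq_eqVlt eq_sym; case: eqP => [x_cost _|_ /= ->]; last by rewrite mulr0.
  rewrite x_cost ltnn subnn path_poly_coef0 // mulrC; congr (_ * _).
  have x_end : x ord_max = z ord_max.
    by apply: separating_cost_end; rewrite ?z_start ?x_start.
  by apply: eq_bigr => l _; rewrite x_end x_start z_start.
rewrite F0 coef0 => /esym/eqP; rewrite mulf_eq0 (negbTE r_neq0) /=.
by rewrite sumrB -mulr_sumr -sum_c subr_eq0 => /eqP.
Qed.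

End LeadingOrder.

(** If no history stopped, the probability of having stopped would be zero at
every time, whatever the chains, and could not have a positive limit. *)
Lemma some_history_stops (R : realType) (N M : nat) (phi : algorithm R N M) :
  (0 < N)%N -> interruptible_algorithm_reversible phi ->
  exists k, exists x : history N M k, 0 < \sum_j phi k j x.
Proof.
move=> N_gt0 phiP; pose i0 := Ordinal N_gt0.
apply: contrapT => never.
have one_gt0 (v : 'I_N) : 0 < (1 : R) by [].
pose e := jump_threshold (fun _ : 'I_N => 1 : R) / 2.
have thr_gt0 := jump_threshold_gt0 one_gt0.
have e_gt0 : 0 < e by rewrite divr_gt0.
have e_lt : e < jump_threshold (fun _ : 'I_N => 1 : R).
  by rewrite ltr_pdivrMr // ltr_pMr // ltr1n.
pose P (l : 'I_M) := jump_mx (fun=> 1%N) (fun _ : 'I_N => 1 : R) e.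
pose rho := start_at R [ffun _ : 'I_M => i0].
have P_admissible (l : 'I_M) :=
  jump_mx_admissible one_gt0 (fun=> isT : (0 < 1)%N) e_gt0 e_lt i0.
have [phi01 _ _ /(_ _ P rho P_admissible (start_at_distr R _))] := phiP.
case=> -[p p_gt0 lim_p] _.
have all0 k : \sum_j stop_output_prob rho P phi k j = 0.
  rewrite exchange_big big1 //= => x _; rewrite -mulr_sumr.
  suff -> : \sum_j phi k j x = 0 by rewrite mulr0.
  apply/eqP; rewrite eq_le sumr_ge0 ?andbT; last first.
    by move=> j _; case/andP: (phi01 k j x).
  by rewrite leNgt; apply/negP => x_stop; apply: never; exists k, x.
have p0 : p = 0.
  apply: (cvg_unique _ lim_p) => //.
  rewrite (_ : (fun k => _) = cst 0); last by apply/funext => k; exact: all0.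
  exact: cvg_cst.
by rewrite p0 ltxx in p_gt0.
Qed.

(** * Two stationary distributions at once *)

Theorem mainTheorem4 (R : realType) (N M : nat) (hN : (2 <= N)%N)
    (hM : (1 <= M)%N) :
  ~ exists phi : algorithm R N M, interruptible_algorithm_reversible phi.
Proof.
case=> phi phiP.
have [k [x x_stop]] := some_history_stops (ltnW hN) phiP.
have [c [c_gt0 balance]] := leading_balance phiP x_stop.
pose i0 := Ordinal (ltnW hN); pose i1 := Ordinal hN.
have := balance (fun=> 1) (fun=> ltr01) i0.
(* Against [s = 1], which gives the weight [1 / N] to [i0], this [s] gives it
   [4 / (N + 3)]; the two differ as [N >= 2]. *)
pose s (v : 'I_N) : R := if v == i0 then 2 else 1.
have s_gt0 v : 0 < s v by rewrite /s; case: ifP.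
rewrite (balance s s_gt0) => /(mulIf (lt0r_neq0 c_gt0)).
rewrite !mxE /=.
have s_i0 : s i0 = 2 by rewrite /s eqxx.
have sum_s : \sum_j s j ^+ 2 = 4 + \sum_(j < N | j != i0) 1.
  rewrite (bigD1 i0) //= s_i0 -natrX; congr (_ + _).
  by apply: eq_bigr => j /negbTE ji; rewrite /s ji expr1n.
have sum_1 : \sum_(j < N) (1 ^+ 2 : R) = 1 + \sum_(j < N | j != i0) 1.
  by under eq_bigr do rewrite expr1n; rewrite (bigD1 i0).
have : 1 <= \sum_(j < N | j != i0) (1 : R).
  by rewrite (bigD1 i1) //= lerDl sumr_ge0.
rewrite sum_s sum_1 s_i0 expr1n; set q := \sum_(j < N | _) _ => q_ge1 /eqP.
rewrite eqr_div; [move/eqP; lra | |]; by rewrite gt_eqF //; lra.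
Qed.
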